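(* Let $A\in\mathbb{R}^{d\times d}$ be symmetric and let $b\in\mathbb{R}^d$ be nonzero with $b\notin\mathrm{Range}(A)$ and $b\notin\mathrm{Null}(A)$. Let $g$ be the grade of $b$ with respect to $A$. Run the conjugate gradient (CG) iteration on $(A,b)$ started at $x_0=0$, and suppose that no unlucky breakdown occurs. Then the CG residuals satisfy $A r_k\neq 0$ for all $0\le k\le g-1$.
   Context: Krylov subspace: $\mathcal{K}_k(A,b)=\mathrm{Span}\{b,Ab,\dots,A^{k-1}b\}$, $k\ge 1$. The grade of $b$ with respect to $A$ is the positive integer $g$ with $\dim\mathcal{K}_k(A,b)=k$ for $k\le g$ and $\dim\mathcal{K}_k(A,b)=g$ for $k>g$. CG iteration (in exact arithmetic): $x_0=0$, $r_0=p_0=b$, and for $k=1,2,\dots$, as long as $\langle p_{k-1},Ap_{k-1}\rangle\neq0$ and $r_{k-1}\ne 0$: $\alpha_{k-1}=\|r_{k-1}\|^2/\langle p_{k-1},Ap_{k-1}\rangle$, $x_k=x_{k-1}+\alpha_{k-1}p_{k-1}$, $r_k=r_{k-1}-\alpha_{k-1}Ap_{k-1}$, $\beta_{k-1}=\|r_k\|^2/\|r_{k-1}\|^2$, $p_k=r_k+\beta_{k-1}p_{k-1}$. No unlucky breakdown (for CG): if $A$ is indefinite, then no generated direction $p_{k-1}$ is a zero-curvature direction, i.e. there is no generated nonzero $p_{k-1}\notin\mathrm{Null}(A)$ with $\langle p_{k-1},Ap_{k-1}\rangle=0$. *)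

(* Defs.v *)
From mathcomp Require Import all_boot all_order all_algebra.
From mathcomp Require Import reals.

Set Implicit Arguments.
Unset Strict Implicit.
Unset Printing Implicit Defensive.

Import GRing.Theory Num.Theory.
Local Open Scope ring_scope.

Definition inner (R : realType) (d : nat) (u v : 'cV[R]_d) : R :=
  (u^T *m v) 0 0.

Definition in_range (R : realType) (d : nat) (A : 'M[R]_d) (b : 'cV[R]_d) :=
  exists x : 'cV[R]_d, A *m x = b.

Definition in_null (R : realType) (d : nat) (A : 'M[R]_d) (b : 'cV[R]_d) :=
  A *m b = 0.

Definition indefinite (R : realType) (d : nat) (A : 'M[R]_d) :=
  (exists u : 'cV[R]_d, 0 < inner u (A *m u)) /\
  (exists u : 'cV[R]_d, inner u (A *m u) < 0).

Definition krylov (R : realType) (d : nat) (A : 'M[R]_d) (b : 'cV[R]_d)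
    (k : nat) : {vspace 'cV[R]_d} :=
  <<[seq A ^+ j *m b | j <- iota 0 k]>>%VS.

Definition is_grade (R : realType) (d : nat) (A : 'M[R]_d) (b : 'cV[R]_d)
    (g : nat) :=
  [/\ (0 < g)%N,
      forall k : nat, (1 <= k <= g)%N -> \dim (krylov A b k) = k
    & forall k : nat, (g < k)%N -> \dim (krylov A b k) = g].

Record cg_state (R : realType) (d : nat) := CGState {
  cg_x : 'cV[R]_d;
  cg_r : 'cV[R]_d;
  cg_p : 'cV[R]_d
}.

Definition cg_init (R : realType) (d : nat) (b : 'cV[R]_d) : cg_state R d :=
  CGState 0 b b.

(* The squared Euclidean norm of r is written [inner r r].  The result is
   [None] exactly when the iteration stops. *)
Definition cg_step (R : realType) (d : nat) (A : 'M[R]_d) (s : cg_state R d) :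
    option (cg_state R d) :=
  let: CGState x r p := s in
  if (inner p (A *m p) != 0) && (r != 0) then
    let alpha := inner r r / inner p (A *m p) in
    let x' := x + alpha *: p in
    let r' := r - alpha *: (A *m p) in
    let beta := inner r' r' / inner r r in
    Some (CGState x' r' (r' + beta *: p))
  else None.

(* [cg A b k = Some s] means that the iteration reaches index k, with
   s = (x_k, r_k, p_k); it is [None] once the iteration has stopped before
   producing the k-th iterate. *)
Definition cg (R : realType) (d : nat) (A : 'M[R]_d) (b : 'cV[R]_d) (k : nat) :
    option (cg_state R d) :=
  iter k (obind (cg_step A)) (Some (cg_init b)).

Definition no_unlucky_breakdown (R : realType) (d : nat) (A : 'M[R]_d)
    (b : 'cV[R]_d) :=
  indefinite A ->
  ~ exists (k : nat) (s : cg_state R d),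
      [/\ cg A b k = Some s, cg_p s != 0, ~ in_null A (cg_p s)
        & inner (cg_p s) (A *m cg_p s) = 0].

(* Main.v *)
Require Import Defs.
From mathcomp Require Import all_boot all_order all_algebra.
From mathcomp Require Import reals.
From mathcomp Require Import ring lra.
Import Order.TTheory GRing.Theory Num.Theory.
Local Open Scope ring_scope.

(** Write [r_k], [p_k] for the residual and the direction at index [k].

    Why the residual is never a null vector.  Both [r_k] and [p_k] are
    polynomials in [A] applied to [b]: [r_k = b - A x_k], and
    [p_k = gamma_k b + A y] where [gamma_0 = 1] and
    [gamma_(k+1) = 1 + beta_k gamma_k], so that [gamma_k >= 1].  A null vector
    of the symmetric matrix [A] is orthogonal to the range of [A].  If
    [A r_(k+1) = 0], then
    [<r_(k+1), p_k> = gamma_k <r_(k+1), b> = gamma_k ||r_(k+1)||^2], while the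
    step length makes [r_(k+1)] orthogonal to [p_k].  Hence [r_(k+1) = 0] and
    [b = A x_(k+1)], which is excluded ([residual_not_in_null]).

    Why the iteration reaches index [g - 1].  The residual never vanishes, so
    only [<p_k, A p_k> = 0] could stop the iteration.  If moreover
    [A p_k <> 0], then the quadratic form of [A] takes both signs on the line
    through [p_k] with direction [A p_k], so [A] is indefinite
    ([isotropic_indefinite]) and [p_k] is an unlucky breakdown.
    If [A p_k = 0], then, as [p_k] has a nonzero component along [A^k b]
    modulo [K_k], the vector [A^(k+1) b] lies in [K_(k+1)]; this is impossible
    below the grade ([direction_not_in_null]).

    All these facts are carried along the iteration by the invariant
    [cg_invariant]. *)

(** * The bilinear form and the sign of a symmetric matrix *)

Section Inner.
Context {R : realType} {d : nat}.
Implicit Types (u v w : 'cV[R]_d) (A : 'M[R]_d).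

Lemma innerC u v : inner u v = inner v u.
Proof. by rewrite /inner -[v in LHS]trmxK -trmx_mul mxE. Qed.

Lemma innerDr u v w : inner u (v + w) = inner u v + inner u w.
Proof. by rewrite /inner mulmxDr mxE. Qed.

Lemma innerZr a u v : inner u (a *: v) = a * inner u v.
Proof. by rewrite /inner -scalemxAr mxE. Qed.

Lemma innerDl u v w : inner (u + v) w = inner u w + inner v w.
Proof. by rewrite innerC innerDr !(innerC w). Qed.

Lemma innerZl a u v : inner (a *: u) v = a * inner u v.
Proof. by rewrite innerC innerZr innerC. Qed.

Lemma inner0r u : inner u 0 = 0.
Proof. by rewrite /inner mulmx0 mxE. Qed.

Lemma inner_sum u : inner u u = \sum_i u i 0 ^+ 2.
Proof. by rewrite /inner mxE; apply: eq_bigr => i _; rewrite mxE expr2. Qed.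

Lemma inner_ge0 u : 0 <= inner u u.
Proof. by rewrite inner_sum sumr_ge0 // => i _; rewrite sqr_ge0. Qed.

Lemma inner_eq0 u : (inner u u == 0) = (u == 0).
Proof.
apply/eqP/eqP => [|->]; last exact: inner0r.
rewrite inner_sum => /eqP; rewrite psumr_eq0; last by move=> i _; rewrite sqr_ge0.
move=> /allP u0; apply/matrixP => i j; rewrite ord1 mxE.
by apply/eqP; rewrite -sqrf_eq0; apply: u0; rewrite mem_index_enum.
Qed.

Lemma inner_gt0 u : u != 0 -> 0 < inner u u.
Proof. by move=> u0; rewrite lt_def inner_eq0 u0 inner_ge0. Qed.

Lemma inner_sym A u v : A^T = A -> inner u (A *m v) = inner v (A *m u).
Proof.
by move=> sA; rewrite innerC /inner trmx_mul sA mulmxA.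
Qed.

Lemma inner_null_range A u v : A^T = A -> A *m u = 0 -> inner u (A *m v) = 0.
Proof. by move=> sA u0; rewrite inner_sym // u0 inner0r. Qed.

(** Along the line [p + t v] with [v = A p], the quadratic form equals
    [t (2 ||v||^2 + t <v, A v>)], which has the sign of [t] for small [t]. *)
Lemma isotropic_indefinite A p :
  A^T = A -> inner p (A *m p) = 0 -> A *m p != 0 -> indefinite A.
Proof.
move=> sA p0 v0; set v := A *m p in p0 v0 *.
have a_gt0 := inner_gt0 v v0; set a := inner v v in a_gt0.
pose c := inner v (A *m v).
have formE t : inner (p + t *: v) (A *m (p + t *: v)) = t * (a *+ 2 + t * c).
  rewrite mulmxDr -scalemxAr !innerDr !innerDl !innerZr !innerZl -/v p0 -/a -/c.
  by rewrite (inner_sym A p v sA) -/v -/a; ring.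
have c_ge0 := normr_ge0 c.
pose t := a / (1 + `|c|).
have t_gt0 : 0 < t by rewrite divr_gt0 // ltr_pwDl.
have tc : t * `|c| < a.
  rewrite -[ltRHS](@divfK _ (1 + `|c|)) -/t; last by rewrite gt_eqF // ltr_pwDl.
  by rewrite ltr_pM2l //; lra.
have [tc_le tc_ge] : t * c <= t * `|c| /\ - (t * `|c|) <= t * c.
  by rewrite -mulrN !ler_pM2l // ler_norm lerNl -normrN ler_norm.
split.
- by exists (p + t *: v); rewrite formE mulr_gt0 //; lra.
- exists (p + (- t) *: v); rewrite formE mulNr oppr_lt0 mulr_gt0 //; lra.
Qed.

End Inner.

(** * Krylov subspaces below the grade *)

Section Krylov.
Context {R : realType} {d : nat} (A : 'M[R]_d) (b : 'cV[R]_d).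

Lemma krylovS k : krylov A b k.+1 = (krylov A b k + <[A ^+ k *m b]>)%VS.
Proof. by rewrite /krylov -[k.+1]addn1 iotaD map_cat span_cat /= span_seq1. Qed.

Lemma krylov_subS k : (krylov A b k <= krylov A b k.+1)%VS.
Proof. by rewrite krylovS addvSl. Qed.

Lemma mem_krylov j k : (j < k)%N -> A ^+ j *m b \in krylov A b k.
Proof.
by move=> jk; apply/memv_span/mapP; exists j; rewrite // mem_iota.
Qed.

Lemma krylov_mul k w : w \in krylov A b k -> A *m w \in krylov A b k.+1.
Proof.
elim: k w => [|k IH] w.
  by rewrite /krylov /= span_nil memv0 => /eqP ->; rewrite mulmx0 mem0v.
rewrite krylovS => /memv_addP[u uK [_ /vlineP[a ->] ->]].
rewrite mulmxDr memvD //; first exact: subvP (krylov_subS _) _ (IH _ uK).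
rewrite -scalemxAr memvZ // mulmxA -[A *m _]/(A * _) -exprS.
exact: mem_krylov.
Qed.

Lemma grade_notin g k : is_grade A b g -> (0 < k < g)%N ->
  A ^+ k *m b \notin krylov A b k.
Proof.
move=> [_ dimK _] /andP[k0 kg]; apply/negP => /[!memvE] sub.
have := dimK k.+1; rewrite krylovS (addv_idPl sub) dimK ?k0 ?(ltnW kg) //.
by move=> /(_ kg) /eqP; rewrite eqn_leq ltnn andbF.
Qed.

End Krylov.

(** * The invariant of the iteration *)

Section Iteration.
Context {R : realType} {d : nat} (A : 'M[R]_d) (b : 'cV[R]_d).

(** [inv_inner] is what makes the step length the exact line search, hence the
    next residual orthogonal to [p_k].  The last two fields say that [r_k] and
    [p_k] are polynomials in [A] of degree at most [k] applied to [b], with a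
    nonzero coefficient of degree [k] for [p_k]. *)
Record cg_invariant (k : nat) (s : cg_state R d) : Prop := CGInvariant {
  inv_residual : cg_r s = b - A *m cg_x s;
  inv_direction : exists gamma y, 1 <= gamma /\ cg_p s = gamma *: b + A *m y;
  inv_inner : inner (cg_r s) (cg_p s) = inner (cg_r s) (cg_r s);
  inv_null : A *m cg_r s != 0;
  inv_krylov : cg_r s \in krylov A b k.+1;
  inv_leading : exists c w, [/\ c != 0, w \in krylov A b k
                              & cg_p s = c *: (A ^+ k *m b) + w] }.

Lemma cg_invariant_init : ~ in_null A b -> cg_invariant 0 (cg_init b).
Proof.
have A0b : A ^+ 0 *m b = b by rewrite expr0 mul1mx.
move=> nb; split=> //=.
- by rewrite mulmx0 subr0.
- by exists 1, 0; rewrite mulmx0 scale1r addr0.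
- exact/eqP.
- by rewrite -[X in X \in _]A0b mem_krylov.
- by exists 1, 0; rewrite oner_eq0 mem0v A0b scale1r addr0.
Qed.

Lemma range_residual_neq0 x r : ~ in_range A b -> r = b - A *m x -> r != 0.
Proof.
move=> nb rE; apply/eqP => r0; apply: nb; exists x.
by apply/esym/eqP; rewrite -subr_eq0 -rE r0.
Qed.

(** A null residual has the same inner product with [b] as with itself, since
    it differs from [b] by an element of the range. *)
Lemma residual_not_in_null x r p gamma y :
    A^T = A -> ~ in_range A b -> r = b - A *m x ->
    0 < gamma -> p = gamma *: b + A *m y -> inner r p = 0 ->
  A *m r != 0.
Proof.
move=> sA nb rE gamma0 pE rp0; apply/eqP => Ar0.
have r_neq0 := range_residual_neq0 x r nb rE.
have bE : b = r + A *m x by rewrite rE subrK.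
move: rp0; rewrite pE innerDr innerZr (inner_null_range A r y sA Ar0) addr0.
rewrite bE innerDr (inner_null_range A r x sA Ar0) addr0 => /eqP.
by rewrite mulf_eq0 inner_eq0 (negPf r_neq0) gt_eqF.
Qed.

(** If [A p = 0], then applying [A] to [p = c A^k b + w] expresses
    [A^(k+1) b] through [A w], which lies in [K_(k+1)]; below the grade this
    contradicts [grade_notin]. *)
Lemma direction_not_in_null g k s : is_grade A b g -> (k.+1 < g)%N ->
  cg_invariant k s -> A *m cg_p s != 0.
Proof.
move=> gr kg [_ _ _ _ _ [c [w [c0 wK ->]]]]; apply/eqP.
rewrite mulmxDr -scalemxAr mulmxA -[A *m A ^+ k]/(A * A ^+ k) -exprS => /eqP.
rewrite addr_eq0 => /eqP cE.
have /negP[] := grade_notin A b g k.+1 gr kg.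
by rewrite -[X in X \in _](scalerK c0) cE memvZ // memvN krylov_mul.
Qed.

Lemma cg_curvature_neq0 g k s :
    A^T = A -> no_unlucky_breakdown A b -> is_grade A b g -> (k.+1 < g)%N ->
    cg A b k = Some s -> cg_invariant k s ->
  inner (cg_p s) (A *m cg_p s) != 0.
Proof.
move=> sA nub gr kg sE inv; apply/eqP => pAp.
have Ap := direction_not_in_null g k s gr kg inv.
apply: (nub (isotropic_indefinite A _ sA pAp Ap)); exists k, s; split=> //.
- by apply: contraNneq Ap => ->; rewrite mulmx0.
- exact/eqP.
Qed.

(** The new [gamma] is [1 + beta gamma], at least [1] because [beta] is a
    quotient of squared norms.  The new leading coefficient is [- alpha c],
    nonzero because [alpha] vanishes only with the residual. *)
Lemma cg_invariant_step k s :
    A^T = A -> ~ in_range A b -> cg_invariant k s ->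
    inner (cg_p s) (A *m cg_p s) != 0 ->
  exists2 s', cg_step A s = Some s' & cg_invariant k.+1 s'.
Proof.
case: s => x r p sA nb [/= rE [gamma [y [gamma1 pE]]] rp _ rK].
move=> [c [w [c0 wK pL]]] pAp.
have r0 := range_residual_neq0 x r nb rE.
rewrite /cg_step pAp r0 /=; eexists; first by [].
set alpha := _ / _; set r' := r - _; set beta := _ / _.
have r'E : r' = b - A *m (x + alpha *: p).
  by rewrite /r' rE mulmxDr -scalemxAr opprD addrA.
have r'p : inner r' p = 0.
  rewrite innerC /r' -scaleNr innerDr innerZr innerC rp mulNr divfK //.
  by rewrite subrr.
have pK : p \in krylov A b k.+1.
  by rewrite pL memvD ?memvZ ?mem_krylov // (subvP (krylov_subS A b k)).
have beta0 : 0 <= beta by rewrite divr_ge0 ?inner_ge0.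
have gamma0 : 0 < gamma by apply: lt_le_trans gamma1.
split=> //=.
- exists (1 + beta * gamma), (beta *: y - (x + alpha *: p)); split.
    by rewrite lerDl mulr_ge0 // ltW.
  rewrite {1}r'E {2}pE mulmxBr -scalemxAr scalerDr scalerDl scale1r scalerA.
  by rewrite -!addrA; congr (_ + _); rewrite addrC -!addrA.
- by rewrite innerDr innerZr r'p mulr0 addr0.
- exact: residual_not_in_null sA nb r'E gamma0 pE r'p.
- rewrite memvB ?memvZ ?krylov_mul //.
  exact: subvP (krylov_subS A b k.+1) _ rK.
- exists (- (alpha * c)), (r - alpha *: (A *m w) + beta *: p); split.
  + by rewrite oppr_eq0 !mulf_neq0 ?invr_eq0 ?inner_eq0.
  + by rewrite memvD ?memvB ?memvZ ?krylov_mul.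
  + rewrite /r' {1}pL mulmxDr -scalemxAr mulmxA -[A *m A ^+ k]/(A * A ^+ k).
    rewrite -exprS scalerDr scalerA opprD scaleNr !addrA; congr (_ + _ + _).
    by rewrite addrC.
Qed.

End Iteration.

Theorem theorem1 (R : realType) (d : nat) (A : 'M[R]_d) (b : 'cV[R]_d) (g : nat)
    (A_sym : A^T = A) (b_neq0 : b != 0)
    (b_range : ~ in_range A b) (b_null : ~ in_null A b)
    (g_grade : is_grade A b g)
    (no_breakdown : no_unlucky_breakdown A b) :
  forall k : nat, (k <= g - 1)%N ->
    exists2 s : cg_state R d, cg A b k = Some s & A *m cg_r s != 0.
Proof.
move=> k kg.
have g_gt0 : (0 < g)%N by case: g_grade.
have {kg} kg : (k < g)%N by rewrite -(subnK g_gt0) addn1 ltnS.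
suff [s sE inv] : exists2 s, cg A b k = Some s & cg_invariant A b k s.
  by exists s => //; apply: inv_null inv.
elim: k kg => [|k IH] kg.
  by exists (cg_init b) => //; apply: cg_invariant_init.
have [s sE inv] := IH (ltnW kg).
have pAp := cg_curvature_neq0 A b g k s A_sym no_breakdown g_grade kg sE inv.
have [s' s'E inv'] := cg_invariant_step A b k s A_sym b_range inv pAp.
by exists s' => //; rewrite /cg iterS -/(cg A b k) sE.
Qed.
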